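(* The poset $(\mathbb{N},\leq)$ with strict order given by $a<b$ if and only if $b-a\geq 2$ is a monoid poset but is not a full semigroup poset.
   Context: $\mathbb{N}=\{0,1,2,\dots\}$. For a semigroup $T$ and a subsemigroup $S<T$ ($S=T$ allowed), define $t\leq_S t' :\iff \exists s\in S:\ ts=t'$ on $T$; when this is a partial order, $P(T,S)$ denotes $(T,\leq_S)$. A poset is a monoid poset if it is isomorphic to $P(N,M)$ for some monoid $N$ and submonoid $M<N$ (same neutral element); it is a full semigroup poset if it is isomorphic to $P(S,S)$ for some semigroup $S$. *)

(* Defs.v *)
From HB Require Import structures.
From Stdlib Require Relation_Definitions.
From mathcomp Require Import all_boot all_order.

Set Implicit Arguments.
Unset Strict Implicit.
Unset Printing Implicit Defensive.

Definition whole (T : semigroupType) : {pred T} := fun=> true.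

Fact whole_mulg_closed (T : semigroupType) : mulg_closed (@whole T).
Proof. by []. Qed.

HB.instance Definition _ (T : semigroupType) :=
  isMulClosed.Build T (@whole T) (@whole_mulg_closed T).

Definition semigroup_le (T : semigroupType) (S : mulgClosed T) (t t' : T) : Prop :=
  exists2 s : T, s \in S & (t * s)%g = t'.

(* The poset X is isomorphic to P(T, S); the first clause is the condition for
   P(T, S) to exist. *)
Definition isom_P d (X : porderType d) (T : semigroupType) (S : mulgClosed T) : Prop :=
  Relation_Definitions.order T (semigroup_le S) /\
  exists2 f : X -> T, bijective f &
    forall x y : X, (x <= y)%O <-> semigroup_le S (f x) (f y).

Definition monoid_poset d (X : porderType d) : Prop :=
  exists (N : monoidType) (M : umagmaClosed N), isom_P X M.

Definition full_semigroup_poset d (X : porderType d) : Prop :=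
  exists S : semigroupType, isom_P X (@whole S).

(* An alias of nat, which already carries its usual order. *)
Definition gap_nat : Type := nat.

HB.instance Definition _ := Choice.on gap_nat.

Definition gap_lt (a b : gap_nat) : bool := (2 <= (b : nat) - (a : nat))%N.

Fact gap_lt_irr : irreflexive gap_lt.
Proof. by move=> a; rewrite /gap_lt subnn. Qed.

Fact gap_lt_trans : transitive gap_lt.
Proof.
move=> b a c; rewrite /gap_lt !ltn_subRL => ab bc.
apply: leq_trans bc; rewrite ltnS leq_add2r.
by apply: leq_trans (leq_addr 1 a) _; rewrite ltnW.
Qed.

Fact gap_display : Order.disp_t. Proof. exact: Order.Disp tt tt. Qed.

HB.instance Definition _ :=
  Order.Lt_isPOrder.Build gap_display gap_nat gap_lt_irr gap_lt_trans.

Fact gap_ltE (a b : gap_nat) : (a < b)%O = (2 <= (b : nat) - (a : nat))%N.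
Proof. by []. Qed.

Fact gap_leE (a b : gap_nat) : (a <= b)%O = (a == b) || (2 <= (b : nat) - (a : nat))%N.
Proof. by []. Qed.

(* Main.v *)
Require Import Defs.
From HB Require Import structures.
From mathcomp Require Import all_boot all_order.
From mathcomp Require Import zify.

Set Implicit Arguments.
Unset Strict Implicit.
Unset Printing Implicit Defensive.

(** Write [a <= b] for the gap order, that is, [a = b] or [a + 2 <= b].

    It is a monoid poset because [a <= b] holds exactly when [b = a + m] for
    some [m] in the numerical monoid generated by 2 and 3, which consists of
    all natural numbers except 1; so the poset is P(N, M) for the additive
    monoid N of natural numbers and this submonoid M.

    It is not a full semigroup poset.  Otherwise an associative operation on
    the natural numbers would have the up-sets of the gap order as principal
    right ideals: [aS = {b | a <= b}] for all [a] ([principal_up_sets]).  Such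
    an operation satisfies two incompatible facts.
    - The product 0 * 0 is not 0 ([mul00_neq0]).  If it were, 0 would fix
      0, 2, 3, 4, ... under left multiplication.  Let c = 0 * 1.  Left
      multiplication by 0 maps the up-set of 1 onto the up-set of c, which
      therefore contains 3 and 4, so that c is 0 or 1; as c lies in the up-set
      of 0, which omits 1, c = 0.  But then 2 >= c would be 0 * x for some
      x >= 1, and these values are 0, 3, 4, ...
    - The product 0 * 0 is 0 ([mul00]).  For each z there is some t with
      z * t = z; either t = 1, or 0 <= t and then z <= z * 0 <= z * t = z.
      Hence z * 0 = z or z * 1 = z ([absorbs_minimal]).  For z = 0, it remains
      to treat the case 0 * 1 = 0.  For z = 1, either 1 * 0 = 1, or 1 * 1 = 1
      and the argument used above for c shows that 1 * 0 = 1 again.  Therefore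
      0 * 0 = (0 * 1) * 0 = 0 * (1 * 0) = 0 * 1 = 0. *)

(** The natural numbers as a multiplicatively written monoid whose law is
    addition. *)
Definition add_nat : Type := nat.

HB.instance Definition _ := Choice.on add_nat.
HB.instance Definition _ := isMonoid.Build add_nat addnA add0n addn0.

(** The numerical monoid generated by 2 and 3. *)
Definition numerical23 : {pred add_nat} := fun m => (m : nat) != 1.

Fact numerical23_mulg_closed : mulg_closed numerical23.
Proof.
move=> a b; rewrite !unfold_in => a1 b1.
by change (a + b != 1); lia.
Qed.

Fact numerical23_1 : (1%g : add_nat) \in numerical23.
Proof. by []. Qed.

HB.instance Definition _ :=
  isMulClosed.Build add_nat numerical23 numerical23_mulg_closed.
HB.instance Definition _ :=
  isMul1Closed.Build add_nat numerical23 numerical23_1.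

(** The gap order, on plain natural numbers. *)
Definition gap (a b : nat) : bool := (a == b) || (a.+1 < b).

Lemma gap_nat_leE (a b : gap_nat) : (a <= b)%O = gap a b.
Proof. by rewrite gap_leE ltn_subRL addn1. Qed.

Lemma semigroup_le_numerical23 (a b : nat) :
  semigroup_le (T := add_nat) numerical23 a b <-> gap a b.
Proof.
split=> [[m m1 <-]|ab].
  by rewrite unfold_in in m1; change (gap a (a + m)); rewrite /gap; lia.
exists (b - a).
  by rewrite unfold_in; move: ab; rewrite /gap; lia.
by change (a + (b - a) = b); move: ab; rewrite /gap; lia.
Qed.

Lemma monoid_poset_gap_nat : monoid_poset gap_nat.
Proof.
exists add_nat, (numerical23 : umagmaClosed add_nat); split.
  split=> [a|a b c|a b]; rewrite !semigroup_le_numerical23 /gap.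
  - lia.
  - lia.
  - by move=> ab ba; change ((a : nat) = b); lia.
exists id => [|a b]; first by exists id.
by rewrite gap_nat_leE semigroup_le_numerical23.
Qed.

(** [mul] is an associative operation on the natural numbers for which the
    principal right ideal of each [a] is the up-set of [a] in the gap order. *)
Definition principal_up_sets (mul : nat -> nat -> nat) : Prop :=
  associative mul /\ forall a b, gap a b <-> exists s, mul a s = b.

Section PrincipalUpSets.

Variable mul : nat -> nat -> nat.
Hypothesis mulP : principal_up_sets mul.

Lemma gap_ex (a b : nat) : gap a b -> exists s, mul a s = b.
Proof. by case: mulP => _ mulE /mulE. Qed.

Lemma gap_mul (a s : nat) : gap a (mul a s).
Proof. by case: mulP => _ mulE; apply/mulE; exists s. Qed.

Lemma mul_mono (z a b : nat) : gap a b -> gap (mul z a) (mul z b).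
Proof. by case: mulP => mulA _ /gap_ex[s <-]; rewrite mulA gap_mul. Qed.

(** Left multiplication by [z] maps the up-set of [a] onto the up-set of
    [mul z a]. *)
Lemma mul_onto (z a y : nat) :
  gap (mul z a) y -> exists2 x, gap a x & mul z x = y.
Proof.
case: mulP => mulA _ /gap_ex[s <-].
by exists (mul a s); rewrite ?gap_mul ?mulA.
Qed.

Lemma mul_idem (e x : nat) : mul e e = e -> gap e x -> mul e x = x.
Proof. by case: mulP => mulA _ ee /gap_ex[s <-]; rewrite mulA ee. Qed.

Lemma absorbs_minimal (z : nat) : mul z 0 = z \/ mul z 1 = z.
Proof.
have [s zs] : exists s, mul z s = z by apply: gap_ex; rewrite /gap eqxx.
have [s1|s1] := eqVneq s 1; [by right; rewrite -{1}s1 | left].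
have := mul_mono z (a := 0) (b := s); rewrite zs.
by have := gap_mul z 0; rewrite /gap; lia.
Qed.

Lemma mul00_neq0 : mul 0 0 <> 0.
Proof.
move=> m00.
have fix0 x : gap 0 x -> mul 0 x = x by apply: mul_idem.
have c3 : gap (mul 0 1) 3 by rewrite -[X in gap _ X]fix0 // mul_mono.
have c4 : gap (mul 0 1) 4 by rewrite -[X in gap _ X]fix0 // mul_mono.
have m01 : mul 0 1 = 0.
  by have := gap_mul 0 1; move: c3 c4; rewrite /gap; lia.
have [x x1] : exists2 x, gap 1 x & mul 0 x = 2 by apply: mul_onto; rewrite m01.
have [-> | xn1] := eqVneq x 1; first by rewrite m01.
by rewrite fix0; move: x1; rewrite /gap; lia.
Qed.

Lemma mul00 : mul 0 0 = 0.
Proof.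
have [//|m01] := absorbs_minimal 0.
have m10 : mul 1 0 = 1.
  have [//|m11] := absorbs_minimal 1.
  have fix1 x : gap 1 x -> mul 1 x = x by apply: mul_idem.
  have c3 : gap (mul 1 0) 3 by rewrite -[X in gap _ X]fix1 // mul_mono.
  have c4 : gap (mul 1 0) 4 by rewrite -[X in gap _ X]fix1 // mul_mono.
  by have := gap_mul 1 0; move: c3 c4; rewrite /gap; lia.
by case: mulP => mulA _; rewrite -{1}m01 -mulA m10.
Qed.

End PrincipalUpSets.

Lemma no_principal_up_sets (mul : nat -> nat -> nat) : ~ principal_up_sets mul.
Proof. by move=> mulP; apply: (mul00_neq0 mulP); apply: mul00. Qed.

Lemma not_full_semigroup_poset_gap_nat : ~ full_semigroup_poset gap_nat.
Proof.
case=> S [_ [f [g fK gK] fle]].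
(* The operation of S, transported to the natural numbers along f. *)
apply: (@no_principal_up_sets (fun a b => g (f a * f b)%g)); split.
  by move=> a b c; rewrite !gK mulgA.
move=> a b; rewrite -gap_nat_leE fle; split=> [[s _ fas]|[s <-]].
  by exists (g s); rewrite gK fas fK.
by exists (f s); rewrite ?gK.
Qed.

Theorem theorem3p1 : monoid_poset gap_nat /\ ~ full_semigroup_poset gap_nat.
Proof.
by split; [exact: monoid_poset_gap_nat | exact: not_full_semigroup_poset_gap_nat].
Qed.
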